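(* Let $D_1$ and $D_2$ be simple digraphs on $n_1$ and $n_2$ vertices, respectively. Suppose $D_1$ has $m_1$ arcs and its underlying graph $G_1=U(D_1)$ has $m_1'$ edges. Then (i) $\displaystyle f_{A(D_1 \overrightarrow{\diamond} D_2)} (\lambda)=\big[f_{A(D_2)}(\lambda)\big]^{m_1}\left(1+\chi_{A(D_2)}(\lambda)\right)^{n_1}f_{A(D_1)}\left(\frac{\lambda}{1+\chi_{A(D_2)}(\lambda)}\right)$, (ii) $\displaystyle f_{A(D_1 \overleftarrow{\diamond} D_2)}(\lambda)= \big[f_{A(D_2)}(\lambda)\big]^{m_1} \det\left(\lambda I_{n_1}-A(D_1)-\chi_{A(D_2)}(\lambda)\,A(D_1)^T\right)$, (iii) $\displaystyle f_{A(D_1 \overleftrightarrow{\diamond} D_2)}(\lambda)= \big[f_{A(D_2)}(\lambda)\big]^{m_1'} \det\left(\lambda I_{n_1}-A(D_1)-\chi_{A(D_2)}(\lambda)\,Q(G_1)\right)$. In particular, the adjacency spectrum of $D_1 \overrightarrow{\diamond} D_2$ is completely determined by the adjacency characteristic polynomials of $D_1$ and $D_2$ and the $A$-coronal of $D_2$.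
   Context: Digraphs are simple. $A(D)$ is the adjacency matrix of $D$ ($A(D)^T$ is the adjacency matrix of the reverse digraph $\overleftarrow{D}_1$). The underlying graph $U(D)$ has the same vertices and an edge $\{u,v\}$ whenever $uv$ or $vu$ is an arc. For a graph $G$, $Q(G)=D_{\rm deg}(G)+A(G)$ is its signless Laplacian, $D_{\rm deg}(G)$ the diagonal degree matrix. $f_M(\lambda)=\det(\lambda I-M)$; for a real $n\times n$ matrix $M$ over $\mathbb{C}(\lambda)$, $\chi_M(\lambda)=\mathbf{1}_n^T(\lambda I_n-M)^{-1}\mathbf{1}_n$ ($\mathbf{1}_n$ all-ones vector), and the $A$-coronal of $D$ is $\chi_{A(D)}$. Arc coronas: the forward-arc-corona $D_1 \overrightarrow{\diamond} D_2$ takes one copy of $D_1$ and $m_1$ disjoint copies of $D_2$, one per arc of $D_1$, and for each arc $a_k=uv$ of $D_1$ and each vertex $w$ of the $k$-th copy of $D_2$ adds arcs $uw$ and $wv$. The backward-arc-corona $D_1 \overleftarrow{\diamond} D_2$ is defined the same way but adds arcs $vw$ and $wu$ instead. The symmetric-arc-corona $D_1 \overleftrightarrow{\diamond} D_2$ takes one copy of $D_1$ and $m_1'$ copies of $D_2$, one per edge of $U(D_1)$, and for each edge $\{u,v\}$ of $U(D_1)$ and each vertex $w$ of the corresponding copy of $D_2$ adds arcs $uw,wu,vw,wv$.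
   Formalization: In the ''in particular'' clause the number m_1 of arcs of D_1 is added to the data determining the spectrum; without it the claim fails (two isolated vertices and a single arc share characteristic polynomial x^2 but give forward-arc-coronas of different orders). *)

(* Defs.v *)
From HB Require Import structures.
From mathcomp Require Import all_boot all_order all_algebra.
From mathcomp Require Import finmap multiset complex reals.

Set Implicit Arguments.
Unset Strict Implicit.
Unset Printing Implicit Defensive.

Import GRing.Theory.
Local Open Scope ring_scope.

(* Opposite arcs [uv] and [vu] may coexist in a simple digraph. *)
Record digraph (V : finType) := Digraph {
  arc :> rel V;
  arc_irrefl : irreflexive arc }.

Record sgraph (V : finType) := SGraph {
  adj :> rel V;
  adj_sym : symmetric adj;
  adj_irrefl : irreflexive adj }.

Definition arcs (V : finType) (D : digraph V) : {set V * V} :=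
  [set a | arc D a.1 a.2].

Definition edges (V : finType) (G : sgraph V) : {set {set V}} :=
  [set e : {set V} | [exists u, exists v, adj G u v && (e == [set u; v])]].

Definition degree (V : finType) (G : sgraph V) (v : V) : nat :=
  #|[set u | adj G v u]|.

Section Underlying.
Variables (V : finType) (D : digraph V).

Definition underlying_rel : rel V := fun u v => arc D u v || arc D v u.

Lemma underlying_sym : symmetric underlying_rel.
Proof. by move=> u v; rewrite /underlying_rel orbC. Qed.

Lemma underlying_irrefl : irreflexive underlying_rel.
Proof. by move=> u; rewrite /underlying_rel (arc_irrefl D). Qed.

Definition underlying : sgraph V := SGraph underlying_sym underlying_irrefl.

End Underlying.

Section Coronas.
Variables (V1 V2 : finType) (D1 : digraph V1) (D2 : digraph V2).

(* The vertex [inr (a, w)] is the vertex [w] in the copy of [D2] attached to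
   the arc [a] of [D1]; [(val a).1] is the tail of [a], [(val a).2] its head. *)
Definition arc_corona_vertex : finType :=
  (V1 + {a : V1 * V1 | a \in arcs D1} * V2)%type.

Definition edge_corona_vertex : finType :=
  (V1 + {e : {set V1} | e \in edges (underlying D1)} * V2)%type.

Definition forward_corona_rel : rel arc_corona_vertex := fun x y =>
  match x, y with
  | inl u, inl v => arc D1 u v
  | inl u, inr (a, _) => u == (val a).1
  | inr (a, _), inl v => v == (val a).2
  | inr (a, w), inr (b, z) => (a == b) && arc D2 w z
  end.

Definition backward_corona_rel : rel arc_corona_vertex := fun x y =>
  match x, y with
  | inl u, inl v => arc D1 u v
  | inl v, inr (a, _) => v == (val a).2
  | inr (a, _), inl u => u == (val a).1
  | inr (a, w), inr (b, z) => (a == b) && arc D2 w z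
  end.

Definition symmetric_corona_rel : rel edge_corona_vertex := fun x y =>
  match x, y with
  | inl u, inl v => arc D1 u v
  | inl u, inr (e, _) => u \in val e
  | inr (e, _), inl u => u \in val e
  | inr (e, w), inr (f, z) => (e == f) && arc D2 w z
  end.

Lemma forward_corona_irrefl : irreflexive forward_corona_rel.
Proof. by case=> [u|[a w]] /=; rewrite ?eqxx (arc_irrefl _). Qed.

Lemma backward_corona_irrefl : irreflexive backward_corona_rel.
Proof. by case=> [u|[a w]] /=; rewrite ?eqxx (arc_irrefl _). Qed.

Lemma symmetric_corona_irrefl : irreflexive symmetric_corona_rel.
Proof. by case=> [u|[a w]] /=; rewrite ?eqxx (arc_irrefl _). Qed.

Definition forward_corona : digraph arc_corona_vertex :=
  Digraph forward_corona_irrefl.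

Definition backward_corona : digraph arc_corona_vertex :=
  Digraph backward_corona_irrefl.

Definition symmetric_corona : digraph edge_corona_vertex :=
  Digraph symmetric_corona_irrefl.

End Coronas.

Section Matrices.
Variable C : fieldType.

Definition adjmx (V : finType) (e : rel V) : 'M[C]_#|V| :=
  \matrix_(i, j) (e (enum_val i) (enum_val j))%:R.

Definition degmx (V : finType) (G : sgraph V) : 'M[C]_#|V| :=
  diag_mx (\row_i (degree G (enum_val i))%:R).

Definition signless_laplacian (V : finType) (G : sgraph V) : 'M[C]_#|V| :=
  degmx G + adjmx G.

Definition ratfun : fieldType := {fraction {poly C}}.

Definition ratfun_const : C -> ratfun := @tofrac {poly C} \o polyC.

(* The indeterminate of [C(lambda)]. *)
Definition lambda : ratfun := tofrac ('X : {poly C}).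

(* [M] regarded as a matrix over [C(lambda)]. *)
Definition ratmx (m n : nat) (M : 'M[C]_(m, n)) : 'M[ratfun]_(m, n) :=
  map_mx ratfun_const M.

(* [f_M (x)], for [x] in [C(lambda)]. *)
Definition charpoly_at (n : nat) (M : 'M[C]_n) (x : ratfun) : ratfun :=
  (map_poly ratfun_const (char_poly M)).[x].

Definition coronal (n : nat) (M : 'M[C]_n) : ratfun :=
  ((const_mx 1 : 'rV_n) *m invmx (lambda%:M - ratmx M)
     *m (const_mx 1 : 'cV_n)) 0 0.

End Matrices.

(* The eigenvalues of [M], counted with algebraic multiplicity. *)
Definition spectrum (C : closedFieldType) (n : nat) (M : 'M[C]_n) : {mset C}%mset :=
  seq_mset (sval (closed_field_poly_normal (char_poly M))).

(* Main.v *)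
Require Import Defs.
From HB Require Import structures.
From mathcomp Require Import all_boot all_order all_algebra.
From mathcomp Require Import finmap multiset complex reals.
From mathcomp Require Import perm mxtens.

Set Implicit Arguments.
Unset Strict Implicit.
Unset Printing Implicit Defensive.

Import GRing.Theory.
Local Open Scope ring_scope.

(* In each corona, a base vertex has the same arcs to and from every vertex of
   a copy of [D2], so ordering the base vertices first turns [lambda - A] into
   [[M, - B (x) 1^T], [- B' (x) 1, I (x) N]], where [M = lambda - A(D1)],
   [N = lambda - A(D2)] and [B], [B'] are incidence matrices between base
   vertices and copies. The Schur complement of the lower right block gives the
   determinant [det N ^ #copies * det (M - chi B B')], and [B B'] counts the
   arcs (or edges) attached to both of two base vertices: it is [A(D1)],
   [A(D1)^T] or [Q(U(D1))] respectively. *)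

(** * Determinants of reindexed, Kronecker and block matrices *)

Lemma det_mxsub_bij (R : comPzRingType) (m n : nat) (f : 'I_m -> 'I_n)
    (A : 'M[R]_n) :
  bijective f -> \det (mxsub f f A) = \det A.
Proof.
move=> bij_f; have := bij_eq_card bij_f; rewrite !card_ord => eq_mn.
case: _ / eq_mn in A f bij_f *.
pose s := perm (bij_inj bij_f).
have -> : mxsub f f A = row_perm s (col_perm s A).
  by apply/matrixP=> i j; rewrite !mxE !permE.
rewrite row_permE col_permE !det_mulmx !det_perm odd_permV mulrCA.
by rewrite -signr_addb addbb mulr1.
Qed.

Lemma det_castmx (R : comPzRingType) (m n : nat) (eq_mn : m = n)
    (A : 'M[R]_m) :
  \det (castmx (eq_mn, eq_mn) A) = \det A.
Proof. by case: _ / eq_mn; rewrite castmx_id. Qed.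

Lemma det_tens1mx (R : comPzRingType) (m n : nat) (N : 'M[R]_n) :
  \det ((1%:M : 'M_m) *t N) = \det N ^+ m.
Proof.
elim: m => [|m IHm]; first exact: det_mx00.
rewrite -[m.+1]/(1 + m)%N scalar_mx_block tens_block_mx !tens0mx det_castmx.
by rewrite det_ublock IHm tens_scalar1mx det_castmx exprS.
Qed.

Section SchurComplement.
Variables (F : fieldType) (m n : nat).
Implicit Types (A : 'M[F]_m) (D : 'M[F]_n).

Lemma det_block_schur A (B : 'M_(m, n)) (C : 'M_(n, m)) D :
  D \in unitmx ->
  \det (block_mx A B C D) = \det D * \det (A - B *m invmx D *m C).
Proof.
(* Left multiplication by the unipotent [U] restores the upper right block [B], so the determinant
   is that of a block lower triangular matrix. *)
move=> uD; pose U := block_mx (1%:M : 'M_m) (B *m invmx D) 0 (1%:M : 'M_n).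
have -> : block_mx A B C D = U *m block_mx (A - B *m invmx D *m C) 0 C D.
  rewrite mulmx_block !mul1mx !mul0mx !add0r.
  by rewrite subrK -[_ *m D]mulmxA mulVmx ?mulmx1.
by rewrite det_mulmx det_ublock !det1 !mul1r det_lblock mulrC.
Qed.

End SchurComplement.

(** The bordered matrix [[1, v], [-u, D]] has its determinant computed twice: by the Schur
    complement of [D], and by clearing [- u] with the unipotent [L]. *)
Lemma det_add_rank1 (F : fieldType) (n : nat) (D : 'M[F]_n) (u : 'cV_n)
    (v : 'rV_n) :
  D \in unitmx ->
  \det (D + u *m v) = \det D * (1 + (v *m invmx D *m u) 0 0).
Proof.
move=> uD; pose L := block_mx (1%:M : 'M[F]_1) 0 (- u) (1%:M : 'M_n).
have := det_block_schur (1%:M : 'M_1) v (- u) uD.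
have -> : block_mx 1%:M v (- u) D = L *m block_mx 1%:M v 0 (D + u *m v).
  rewrite mulmx_block !mul1mx !mul0mx mulmx1 !addr0 mulNmx.
  by rewrite addrCA addNr addr0.
rewrite det_mulmx det_lblock det_ublock !det1 !mul1r => ->.
by rewrite mulmxN opprK [1%:M + _]mx11_scalar det_scalar1 !mxE eqxx.
Qed.

(** * Characteristic polynomials over the field of rational functions *)

HB.instance Definition _ (C : fieldType) :=
  GRing.RMorphism.copy (@ratfun_const C) (@tofrac {poly C} \o polyC).

Section RationalFunctions.
Variable C : fieldType.
Local Notation lam := (lambda C).

(** Horner evaluation at [x] is a ring morphism, so it passes through the determinant. *)
Lemma charpoly_atE (n : nat) (A : 'M[C]_n) (x : ratfun C) :
  charpoly_at A x = \det (x%:M - ratmx A).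
Proof.
rewrite /charpoly_at map_char_poly.
rewrite -[LHS]/(horner_eval x _) -det_map_mx; congr (\det _).
by apply/matrixP=> i j; rewrite !mxE /= /horner_eval hornerD hornerN hornerMn
  hornerX hornerC.
Qed.

(** Composing a polynomial with 'X leaves it unchanged. Since [tofrac] is injective, facts about
    characteristic polynomials can be moved to and from C(lambda). *)
Lemma charpoly_at_lambda (n : nat) (A : 'M[C]_n) :
  charpoly_at A lam = tofrac (char_poly A).
Proof.
rewrite /charpoly_at -[X in _ = tofrac X]comp_polyXr /comp_poly -horner_map.
by rewrite -map_poly_comp.
Qed.

Lemma charpoly_at_lambda_neq0 (n : nat) (A : 'M[C]_n) :
  charpoly_at A lam != 0.
Proof.
by rewrite charpoly_at_lambda tofrac_eq0 monic_neq0 ?char_poly_monic.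
Qed.

Lemma resolvent_unit (n : nat) (A : 'M[C]_n) : lam%:M - ratmx A \in unitmx.
Proof.
by rewrite unitmxE unitfE -charpoly_atE charpoly_at_lambda_neq0.
Qed.

(* [(1 + coronal A) f_A] is the characteristic polynomial of [A - J], with [J]
   the all-ones matrix; characteristic polynomials are nonzero. *)
Lemma coronal1_neq0 (n : nat) (A : 'M[C]_n) : 1 + coronal A != 0.
Proof.
have := charpoly_at_lambda_neq0 (A - const_mx 1).
apply: contraNneq => chi0.
rewrite charpoly_atE.
have -> : lam%:M - ratmx (A - const_mx 1) =
    lam%:M - ratmx A + (const_mx 1 : 'cV_n) *m (const_mx 1 : 'rV_n).
  apply/matrixP=> i j; rewrite !mxE big_ord1 !mxE mulr1.
  by rewrite rmorphB rmorph1 opprB addrA addrAC.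
by rewrite det_add_rank1 ?resolvent_unit // -/(coronal A) chi0 mulr0.
Qed.

End RationalFunctions.

(** * Determinant of a block matrix of corona shape *)

Lemma tens1mx1 (R : pzRingType) (m n : nat) :
  (1%:M : 'M[R]_m) *t (1%:M : 'M_n) = 1%:M.
Proof.
apply/matrixP=> k l; case: (mxtens_indexP k) => i j.
case: (mxtens_indexP l) => i' j'; rewrite tensmxE !mxE.
by rewrite (can_eq (@mxtens_indexK _ _)) xpair_eqE -natrM mulnb.
Qed.

Lemma tens1mx_unit (R : comUnitRingType) (m n : nat) (N : 'M[R]_n) :
  N \in unitmx -> (1%:M : 'M_m) *t N \in unitmx.
Proof. by rewrite !unitmxE det_tens1mx; apply: unitrX. Qed.

Lemma invmx_tens1mx (R : comUnitRingType) (m n : nat) (N : 'M[R]_n) :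
  N \in unitmx -> invmx ((1%:M : 'M_m) *t N) = 1%:M *t invmx N.
Proof.
move=> uN; apply: (can_inj (mulKmx (tens1mx_unit m uN))).
by rewrite mulmxV ?tens1mx_unit // tensmx_mul mul1mx mulmxV // tens1mx1.
Qed.

Lemma det_tens_corona (F : fieldType) (n m p : nat) (M : 'M[F]_n) (N : 'M_p)
    (B : 'M_(n, m)) (B' : 'M_(m, n)) :
  N \in unitmx ->
  \det (block_mx (M *t (1%:M : 'M_1)) (B *t (const_mx 1 : 'rV_p))
      (B' *t (const_mx 1 : 'cV_p)) ((1%:M : 'M_m) *t N)) =
    \det N ^+ m
    * \det (M - ((const_mx 1 : 'rV_p) *m invmx N *m (const_mx 1 : 'cV_p)) 0 0
              *: (B *m B')).
Proof.
move=> uN; rewrite det_block_schur ?tens1mx_unit // det_tens1mx.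
rewrite invmx_tens1mx // !tensmx_mul mulmx1.
(* The mixed-product rule has turned the Schur correction into [B *m B'] tensored with a 1 by 1
   matrix, which is therefore a scalar. *)
rewrite {1}[const_mx 1 *m _ *m _]mx11_scalar; set chi := (_ *m _) 0 0.
have -> : M *t 1%:M - (B *m B') *t chi%:M =
    (M - chi *: (B *m B')) *t (1%:M : 'M_1).
  apply/matrixP=> k l; case: (mxtens_indexP k) => i j.
  case: (mxtens_indexP l) => i' j'; rewrite [LHS]mxE [X in _ + X]mxE !tensmxE.
  rewrite (ord1 j) (ord1 j') [X in _ = X * _]mxE [X in _ = (_ + X) * _]mxE.
  by rewrite [X in _ = (_ - X) * _]mxE !mxE !mulr1n !mulr1 mulrC.
by rewrite tens_mx_scalar det_castmx scale1r.
Qed.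

(** * Characteristic polynomial of a generic corona *)

Section GenericCorona.
Variables (C : fieldType) (V1 V2 S : finType).
Variables (e1 : rel V1) (e2 : rel V2) (e : rel (V1 + S * V2)%type).
Variables (to_copy : V1 -> S -> bool) (from_copy : S -> V1 -> bool).
Hypotheses (e_base : forall u v, e (inl u) (inl v) = e1 u v)
  (e_to : forall u s w, e (inl u) (inr (s, w)) = to_copy u s)
  (e_from : forall s w v, e (inr (s, w)) (inl v) = from_copy s v)
  (e_copy : forall s w t z,
     e (inr (s, w)) (inr (t, z)) = (s == t) && e2 w z).

Local Notation lam := (lambda C).

(* The base vertices are numbered by ['I_(#|V1| * 1)], so that all four blocks
   of [lambda - A] become Kronecker products. *)
Let vertex (k : 'I_(#|V1| * 1 + #|S| * #|V2|)) : (V1 + S * V2)%type :=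
  match split k with
  | inl i => inl (enum_val (mxtens_unindex i).1)
  | inr j =>
      inr (enum_val (mxtens_unindex j).1, enum_val (mxtens_unindex j).2)
  end.

Let vertexl i k : vertex (lshift _ (mxtens_index (i, k))) = inl (enum_val i).
Proof. by rewrite /vertex (unsplitK (inl _)) mxtens_indexK. Qed.

Let vertexr s w :
  vertex (rshift _ (mxtens_index (s, w))) = inr (enum_val s, enum_val w).
Proof. by rewrite /vertex (unsplitK (inr _)) mxtens_indexK. Qed.

Let vertex_bij : bijective (enum_rank \o vertex).
Proof.
apply: inj_card_bij => [k l /enum_rank_inj|]; last first.
  by rewrite !card_ord card_sum card_prod muln1.
case: (split_ordP k) => k' ->; case: (split_ordP l) => l' ->;
  case: (mxtens_indexP k') => i j; case: (mxtens_indexP l') => i' j';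
  rewrite ?(vertexl, vertexr) //.
  by case=> /enum_val_inj->; rewrite (ord1 j) (ord1 j').
by case=> /enum_val_inj-> /enum_val_inj->.
Qed.

(** The three coronas differ only in the index set [S] and in [to_copy] and [from_copy]. The matrix
    next to the coronal counts the copies that can be entered from i and left towards j. *)
Lemma charpoly_corona :
  charpoly_at (adjmx C e) lam =
    charpoly_at (adjmx C e2) lam ^+ #|S|
    * \det (lam%:M - ratmx (adjmx C e1) - coronal (adjmx C e2) *:
        ratmx (\matrix_(i, j)
          #|[set s | to_copy (enum_val i) s && from_copy s (enum_val j)]|%:R)).
Proof.
rewrite !charpoly_atE -[LHS](det_mxsub_bij _ vertex_bij).
set A2 := adjmx C e2; set M := lam%:M - ratmx (adjmx C e1).
set N := lam%:M - ratmx A2.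
(* The signs come from [lam%:M - A]; they cancel in [B *m B']. *)
pose B : 'M[ratfun C]_(#|V1|, #|S|) :=
  \matrix_(i, s) - (to_copy (enum_val i) (enum_val s))%:R.
pose B' : 'M[ratfun C]_(#|S|, #|V1|) :=
  \matrix_(s, j) - (from_copy (enum_val s) (enum_val j))%:R.
have uN : N \in unitmx := resolvent_unit A2.
have -> : mxsub (enum_rank \o vertex) (enum_rank \o vertex)
      (lam%:M - ratmx (adjmx C e)) =
    block_mx (M *t (1%:M : 'M_1)) (B *t (const_mx 1 : 'rV_#|V2|))
      (B' *t (const_mx 1 : 'cV_#|V2|)) ((1%:M : 'M_#|S|) *t N).
  apply/matrixP=> k l; rewrite mxE.
  case: (split_ordP k) => k' ->; case: (split_ordP l) => l' ->;
    case: (mxtens_indexP k') => i j; case: (mxtens_indexP l') => i' j';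
    rewrite ?(block_mxEul, block_mxEur, block_mxEdl, block_mxEdr);
    rewrite tensmxE !mxE /= (inj_eq enum_rank_inj);
    rewrite !enum_rankK ?(vertexl, vertexr) ?(e_base, e_to, e_from, e_copy);
    rewrite ?rmorph_nat ?mulr1 ?mulr0n ?sub0r //.
    (* The off-diagonal blocks are settled; the base block and then the block of copies remain. *)
    rewrite (ord1 j) (ord1 j') eqxx mulr1.
    by rewrite (inj_eq inl_inj) (inj_eq enum_val_inj).
  rewrite (inj_eq inr_inj) xpair_eqE !(inj_eq enum_val_inj).
  by case: eqP; rewrite ?mul1r // mul0r subr0.
have -> : ratmx (\matrix_(i, j)
      #|[set s | to_copy (enum_val i) s && from_copy s (enum_val j)]|%:R) =
    B *m B'; last exact: (det_tens_corona _ _ _ uN).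
apply/matrixP=> i j; rewrite !mxE rmorph_nat cardsE -sum1_card natr_sum.
rewrite big_mkcond (reindex _ (onW_bij _ (enum_val_bij _))) /=.
apply: eq_bigr => s _; rewrite !mxE mulrNN -natrM mulnb unfold_in.
by case: (_ && _).
Qed.

End GenericCorona.

(** * Counting the arcs and edges attached to two vertices *)

Lemma card_set_sig (T : finType) (A : {set T}) (P : pred T) :
  #|[set s : {a | a \in A} | P (val s)]| = #|[set a in A | P a]|.
Proof.
rewrite -(card_imset _ val_inj); apply: eq_card => a; rewrite !inE.
apply/imsetP/andP => [[s + ->]|[Aa Pa]]; first by rewrite inE (valP s).
by exists (Sub a Aa); rewrite ?inE SubK.
Qed.

Section Counting.
Variable V : finType.

Lemma card_arcs_between (D : digraph V) (u v : V) :
  #|[set a in arcs D | (u == a.1) && (v == a.2)]| = D u v.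
Proof.
have -> : [set a in arcs D | (u == a.1) && (v == a.2)] =
    [set a in pred1 (u, v) | D u v].
  apply/setP=> -[x y]; rewrite !inE xpair_eqE (eq_sym x) (eq_sym y) andbC /=.
  by case: eqP => //= <-; case: eqP => //= <-.
case: (D u v); last by apply: eq_card0 => a; rewrite !inE andbF.
by rewrite -[RHS](card1 (u, v)); apply: eq_card => a; rewrite !inE andbT.
Qed.

Lemma mem_edges2 (G : sgraph V) (u v : V) :
  u != v -> ([set u; v] \in edges G) = G u v.
Proof.
rewrite inE => neq_uv; apply/existsP/idP => [[x /existsP[y]]|Guv].
  case/andP=> Gxy /eqP eq_uv; have := set21 u v; have := set22 u v.
  rewrite eq_uv !inE => v_xy u_xy; move: v_xy u_xy neq_uv.
  by move=> /orP[]/eqP-> /orP[]/eqP->; rewrite ?eqxx // adj_sym.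
by exists u; apply/existsP; exists v; rewrite Guv eqxx.
Qed.

(** These are the entries of the signless Laplacian. For u = v, sending a neighbour w to {u, w} is
    injective because there are no loops; for distinct u and v, the only candidate is {u, v}. *)
Lemma card_edges_through (G : sgraph V) (u v : V) :
  #|[set e in edges G | (u \in e) && (v \in e)]| =
    ((if u == v then degree G u else 0) + G u v)%N.
Proof.
have edgeP e :
    reflect (exists x y, adj G x y /\ e = [set x; y]) (e \in edges G).
  rewrite inE; apply: (iffP existsP) => -[x].
    by case/existsP=> y /andP[Gxy /eqP->]; exists x, y.
  by case=> y [Gxy ->]; exists x; apply/existsP; exists y; rewrite Gxy eqxx.
have [<-{v}|neq_uv] := eqVneq u v.
  rewrite (adj_irrefl G) addn0 /degree.
  rewrite -(card_in_imset (f := fun w => [set u; w])); last first.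
    move=> w x; rewrite !inE => Guw Gux /setP/(_ w).
    rewrite !inE eqxx orbT => /esym/orP[]/eqP // eq_wu.
    by rewrite eq_wu (adj_irrefl G) in Guw.
  apply: eq_card => e; rewrite inE andbb; apply/andP/imsetP.
    case=> /edgeP[x [y [Gxy ->]]]; rewrite !inE => /orP[]/eqP->.
      by exists y; rewrite ?inE.
    by exists x; [rewrite inE adj_sym | rewrite setUC].
  case=> w; rewrite inE => Guw ->; split; last by rewrite !inE eqxx.
  by apply/edgeP; exists u, w.
rewrite add0n -(mem_edges2 G neq_uv).
have edge_uv e : e \in edges G -> u \in e -> v \in e -> e = [set u; v].
  case/edgeP=> x [y [_ eq_e]] u_e v_e.
  (* The pair {u, v} lies in [e], which has at most two elements. *)
  apply/esym/eqP; rewrite eqEcard subUset !sub1set u_e v_e eq_e !cards2.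
  by rewrite neq_uv ltnS leq_b1.
have -> : [set e in edges G | (u \in e) && (v \in e)] =
    [set e in [set [set u; v]] | [set u; v] \in edges G].
  apply/setP=> e; apply/setIdP/setIdP => [[Ge /andP[u_e v_e]]|[/set1P-> Guv]].
    by rewrite -(edge_uv e) // set11.
  by rewrite Guv set21 set22.
case: (_ \in edges G); last by apply: eq_card0 => e; rewrite inE andbF.
by rewrite -[RHS](cards1 [set u; v]); apply: eq_card => e; rewrite inE andbT.
Qed.

End Counting.

(** * The forward, backward and symmetric coronas *)

Section ArcCoronas.
Variables (C : fieldType) (V1 V2 : finType).
Variables (D1 : digraph V1) (D2 : digraph V2).
Local Notation lam := (lambda C).
Local Notation A1 := (adjmx C D1).
Local Notation A2 := (adjmx C D2).
Local Notation chi2 := (coronal A2).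

Lemma charpoly_forward_corona :
  charpoly_at (adjmx C (forward_corona D1 D2)) lam =
    charpoly_at A2 lam ^+ #|arcs D1| * (1 + chi2) ^+ #|V1|
      * charpoly_at A1 (lam / (1 + chi2)).
Proof.
have chi_neq0 := coronal1_neq0 A2.
rewrite (@charpoly_corona C V1 V2 _ D1 D2 (forward_corona D1 D2)
  (fun u a => u == (val a).1) (fun a v => v == (val a).2)
  (fun _ _ => erefl) (fun _ _ _ => erefl) (fun _ _ _ => erefl)
  (fun _ _ _ _ => erefl)).
(* The power of 1 + chi2 becomes a scaling inside the determinant: (1 + chi2) (lam / (1 + chi2) -
   A1) = lam - A1 - chi2 A1, where [chi_neq0] justifies the cancellation. *)
rewrite card_sig -mulrA [charpoly_at A1 _]charpoly_atE -detZ.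
congr (_ * \det _).
apply/matrixP=> i j; rewrite !mxE.
rewrite (card_set_sig _ (fun a => (enum_val i == a.1) && (enum_val j == a.2))).
rewrite card_arcs_between.
by rewrite mulrBr mulrnAr mulrCA divff // mulr1 mulrDl mul1r opprD addrA.
Qed.

Lemma charpoly_backward_corona :
  charpoly_at (adjmx C (backward_corona D1 D2)) lam =
    charpoly_at A2 lam ^+ #|arcs D1|
      * \det (lam%:M - ratmx A1 - chi2 *: (ratmx A1)^T).
Proof.
rewrite (@charpoly_corona C V1 V2 _ D1 D2 (backward_corona D1 D2)
  (fun v a => v == (val a).2) (fun a u => u == (val a).1)
  (fun _ _ => erefl) (fun _ _ _ => erefl) (fun _ _ _ => erefl)
  (fun _ _ _ _ => erefl)).
rewrite card_sig; congr (_ * \det (_ - _ *: _)).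
(* A copy is entered from the head of its arc and left towards the tail, so entry (i, j) counts arcs
   from j to i: hence the transpose. *)
apply/matrixP=> i j; rewrite !mxE -card_arcs_between -card_set_sig.
by congr (ratfun_const _%:R); apply: eq_card => a; rewrite !inE andbC.
Qed.

Lemma charpoly_symmetric_corona :
  charpoly_at (adjmx C (symmetric_corona D1 D2)) lam =
    charpoly_at A2 lam ^+ #|edges (underlying D1)|
      * \det (lam%:M - ratmx A1
                - chi2 *: ratmx (signless_laplacian C (underlying D1))).
Proof.
rewrite (@charpoly_corona C V1 V2 _ D1 D2 (symmetric_corona D1 D2)
  (fun u e => u \in val e) (fun e u => u \in val e)
  (fun _ _ => erefl) (fun _ _ _ => erefl) (fun _ _ _ => erefl)
  (fun _ _ _ _ => erefl)).
rewrite card_sig; congr (_ * \det (_ - _ *: _)).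
apply/matrixP=> i j; rewrite !mxE; congr ratfun_const.
rewrite (card_set_sig _
  (fun e : {set V1} => (enum_val i \in e) && (enum_val j \in e))).
rewrite card_edges_through.
by rewrite natrD (inj_eq enum_val_inj); case: eqP.
Qed.

End ArcCoronas.

Lemma eq_spectrum (C : closedFieldType) (m n : nat) (A : 'M[C]_m)
    (B : 'M[C]_n) :
  char_poly A = char_poly B -> spectrum A = spectrum B.
Proof. by rewrite /spectrum => ->. Qed.

Theorem theorem4p3 (R : realType) (V1 V2 : finType)
    (D1 : digraph V1) (D2 : digraph V2) :
  let C : closedFieldType := R[i] in
  let n1 := #|V1| in
  let m1 := #|arcs D1| in
  let G1 := underlying D1 in
  let m1' := #|edges G1| in
  let A1 : 'M[C]_n1 := adjmx C D1 in
  let A2 : 'M[C]_#|V2| := adjmx C D2 in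
  let lam := lambda C in
  let chi2 := coronal A2 in
  [/\ charpoly_at (adjmx C (forward_corona D1 D2)) lam =
        charpoly_at A2 lam ^+ m1 * (1 + chi2) ^+ n1
          * charpoly_at A1 (lam / (1 + chi2)),
      charpoly_at (adjmx C (backward_corona D1 D2)) lam =
        charpoly_at A2 lam ^+ m1
          * \det (lam%:M - ratmx A1 - chi2 *: (ratmx A1)^T),
      charpoly_at (adjmx C (symmetric_corona D1 D2)) lam =
        charpoly_at A2 lam ^+ m1'
          * \det (lam%:M - ratmx A1
                    - chi2 *: ratmx (signless_laplacian C G1))
    & forall (W1 W2 : finType) (E1 : digraph W1) (E2 : digraph W2),
        #|arcs E1| = m1 ->
        char_poly (adjmx C E1) = char_poly A1 ->
        char_poly (adjmx C E2) = char_poly A2 ->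
        coronal (adjmx C E2) = chi2 ->
        spectrum (adjmx C (forward_corona E1 E2)) =
        spectrum (adjmx C (forward_corona D1 D2))].
Proof.
move=> C n1 m1 G1 m1' A1 A2 lam chi2.
split; [exact: charpoly_forward_corona | exact: charpoly_backward_corona
  | exact: charpoly_symmetric_corona |].
move=> W1 W2 E1 E2 eq_m eq_A1 eq_A2 eq_chi; apply: eq_spectrum.
(* The order of [E1] is read off the degree of its characteristic polynomial. *)
have eq_n : #|W1| = n1.
  by apply: succn_inj; rewrite -(size_char_poly A1) -eq_A1 size_char_poly.
(* The polynomials are compared in C(lambda), where the forward formula involves only quantities
   already known to agree. *)
apply/eqP; rewrite -tofrac_eq -!charpoly_at_lambda !charpoly_forward_corona.
by rewrite /charpoly_at eq_A1 eq_A2 eq_chi eq_m eq_n.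
Qed.
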